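(* Let $G$ be a labeled graph with vertex set $[n]$. Then $G$ is $12$-representable by a $211$-avoiding word if and only if none of the following occurs: (a) vertices $x<y<z$ with $xy, yz\in E(G)$ and $xz\notin E(G)$; (b) vertices $x<y<z<w$ with $xw, yz\in E(G)$ and $xy, yw\notin E(G)$; (c) vertices $x<y<z<w$ with $xz, yw\in E(G)$ and $xy, yz\notin E(G)$.
   Context: All graphs are finite, simple and undirected. Let $[n]=\{1,\ldots,n\}$. For a word $w$ over positive integers, $\mathrm{red}(w)$ is the word obtained from $w$ by replacing each occurrence of the $i$th smallest letter with $i$. For a word (pattern) $p=p_1\cdots p_k$ with $\mathrm{red}(p)=p$, a word $w=w_1\cdots w_\ell$ contains $p$ if there are indices $i_1<\cdots<i_k$ with $\mathrm{red}(w_{i_1}\cdots w_{i_k})=p$; otherwise $w$ avoids $p$ (is $p$-avoiding). A labeled graph with vertex set $[n]$ is $12$-represented by a word $w$ over $[n]$ containing at least one copy of each letter of $[n]$ if for all $i<j$ in $[n]$: $i$ and $j$ are adjacent if and only if every occurrence of $j$ precedes every occurrence of $i$ in $w$. A labeled graph is $12$-representable by a $p$-avoiding word if it is $12$-represented, with its given labels, by some $p$-avoiding word. *)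

(* Defs.v *)
From mathcomp Require Import all_boot.

Set Implicit Arguments.
Unset Strict Implicit.
Unset Printing Implicit Defensive.

(* A labeled graph on [n] = {1, ..., n} is a symmetric irreflexive relation on
   'I_n, the ordinal i being the vertex labeled i + 1.  A word over [n] is a
   sequence over 'I_n, read as a word over positive integers by [letters]. *)

Definition letters (n : nat) (w : seq 'I_n) : seq nat :=
  [seq (nat_of_ord i).+1 | i <- w].

(* x is the i-th smallest letter of w, where i is the number of distinct
   letters of w that are at most x. *)
Definition red (w : seq nat) : seq nat :=
  [seq size (undup [seq y <- w | y <= x]) | x <- w].

(* Intended for patterns p with red p = p. *)
Definition contains (p w : seq nat) : Prop :=
  exists2 u : seq nat, subseq u w & red u = p.

Definition avoids (p w : seq nat) : Prop := ~ contains p w.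

Definition all_precede (T : Type) (w : seq T) (j i : T) : Prop :=
  forall a b : nat, onth w a = Some j -> onth w b = Some i -> a < b.

Definition represents12 (n : nat) (w : seq 'I_n) (G : rel 'I_n) : Prop :=
  (forall i : 'I_n, i \in w) /\
  (forall i j : 'I_n, i < j -> (G i j <-> all_precede w j i)).

Definition representable12_avoiding (p : seq nat) (n : nat) (G : rel 'I_n) :
    Prop :=
  exists2 w : seq 'I_n, represents12 w G & avoids p (letters w).

Definition p211 : seq nat := [:: 2; 1; 1].

Lemma red_p211 : red p211 = p211.
Proof. by []. Qed.

(* Main.v *)
Require Import Defs.
From mathcomp Require Import all_boot.

(** Only the first and the last occurrence of a letter matter for the graph.
    In a 211-avoiding word a letter that occurs twice has its first occurrence
    before all larger letters, hence has no larger neighbor.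

    Necessity.  A vertex [y] with a larger neighbor [t] cannot occur twice,
    since all copies of [t] come first and [t y y] would be a copy of 211
    ([p211_of_repeat]).  Each of (b) and (c) has such a vertex [y], together
    with vertices [x] and [v] such that some [x] precedes some [y], some [y]
    precedes some [v], but no [x] precedes any [v]; this forces two copies of
    [y] ([subseq_repeat]).  Configuration (a) is impossible for every word, as
    complete precedence is transitive.

    Sufficiency.  List in increasing order the vertices without a larger
    neighbor, and append a permutation [s] of all the vertices.  This word
    avoids 211 whatever [s] is ([avoids_p211_cat]).  The prefix makes its
    letters nonadjacent to all larger letters, as required; the remaining
    pairs [i < j], in which [i] has a larger neighbor, ask that [s] put [j]
    before [i] when they are adjacent and [i] before [j] when they are not.
    Call this requirement [must_precede].  The smallest vertex of a cycle of
    requirements has a larger neighbor, namely its predecessor; it is then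
    comparable with every larger vertex, so that cycles reduce to 3-cycles,
    and (a), (b) and (c) exclude these ([no_3cycle]).  A permutation [s]
    meeting all the requirements is then produced by quicksort, pivoting at
    the smallest vertex ([quicksort_ordering]). *)

Set Implicit Arguments.
Unset Strict Implicit.
Unset Printing Implicit Defensive.

(** * Subsequences of length two and three *)

Section Subseq.

Variable T : eqType.
Implicit Types (x y v t : T) (w s : seq T).

Lemma subseq_split u s1 s2 : subseq u (s1 ++ s2) ->
  exists u1 u2 : seq T, [/\ u = u1 ++ u2, subseq u1 s1 & subseq u2 s2].
Proof.
case/subseqP=> m sz_m ->.
have sz_take : size (take (size s1) m) = size s1.
  by rewrite size_takel // sz_m size_cat leq_addr.
exists (mask (take (size s1) m) s1), (mask (drop (size s1) m) s2).
split; rewrite ?mask_subseq //.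
by rewrite -mask_cat // cat_take_drop.
Qed.

Lemma subseq2_total w x y : x != y -> x \in w -> y \in w ->
  subseq [:: x; y] w || subseq [:: y; x] w.
Proof.
move=> neq_xy; case/splitPr=> s1 s2.
rewrite mem_cat inE eq_sym (negPf neq_xy) /= => /orP[y1 | y2].
  apply/orP; right; rewrite -[[:: y; x]]/([:: y] ++ [:: x]).
  by apply: cat_subseq; rewrite sub1seq // mem_head.
apply/orP; left; apply: subseq_trans (suffix_subseq s1 _).
by rewrite /= eqxx sub1seq.
Qed.

Lemma all_precedeP w x y : x != y ->
  all_precede w y x <-> ~~ subseq [:: x; y] w.
Proof.
move=> neq_xy; split.
  move=> prec; apply/negP => sub_xy.
  suff [a [b [lt_ab wa wb]]] :
      exists a b, [/\ a < b, onth w a = Some x & onth w b = Some y].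
    by have := prec b a wb wa; rewrite ltnNge (ltnW lt_ab).
  elim: w sub_xy {prec} => //= h w IHw.
  case: (x =P h) => [-> | _ /IHw[a [b [lt_ab wa wb]]]]; last first.
    by exists a.+1, b.+1.
  by rewrite sub1seq => /onthP[b wb]; exists 0, b.+1.
elim: w => [|h w IHw] nsub a b; first by rewrite onth0n.
have nsub_w : ~~ subseq [:: x; y] w.
  by apply: contra nsub => /subseq_trans; apply; apply: subseq_cons.
case: a b => [|a] [|b] //=; last exact: IHw.
  by move=> [->] [eq_yx]; rewrite eq_yx eqxx in neq_xy.
move=> wa [eq_hx]; case/negP: nsub; rewrite /= eq_hx eqxx sub1seq.
by apply/onthP; exists a.
Qed.

(** The copy of [y] that follows some [x] comes after the last [v], while
    another copy of [y] precedes some [v]. *)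
Lemma subseq_repeat w x y v : x != y ->
    subseq [:: x; y] w -> subseq [:: y; v] w -> ~~ subseq [:: x; v] w ->
  subseq [:: y; y] w.
Proof.
move=> neq_xy; elim: w => //= h w IHw.
case: (x =P h) => [<- | _]; rewrite ?sub1seq.
  rewrite eq_sym (negPf neq_xy) => _ yv /negP[].
  by rewrite -sub1seq (subseq_trans _ yv) // subseq_cons.
case: (y =P h) => [_ xy _ _ | _]; last exact: IHw.
by rewrite (subseq_trans _ xy) // subseq_cons.
Qed.

Lemma subseq_precede_repeat w t y : t != y -> t \in w ->
    ~~ subseq [:: y; t] w -> subseq [:: y; y] w ->
  subseq [:: t; y; y] w.
Proof.
move=> neq_ty; case/splitPr=> s1 s2 nyt.
have y_s1 : y \notin s1.
  apply: contra nyt => y1; rewrite -[[:: y; t]]/([:: y] ++ [:: t]).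
  by apply: cat_subseq; rewrite sub1seq // mem_head.
case/subseq_split=> u1 [u2 [def_u sub1 sub2]].
case: u1 def_u sub1 => [|h u1] /= def_u; last first.
  case: def_u => <- _ sub1; case/negP: y_s1.
  by apply: (mem_subseq sub1); rewrite mem_head.
move=> _; apply: subseq_trans (suffix_subseq s1 _).
by move: sub2; rewrite -def_u /= eqxx eq_sym (negPf neq_ty).
Qed.

End Subseq.

(** * The pattern 211 *)

(** [red] is strictly monotone on letters, which makes it possible to recover
    the relative order of the letters from the pattern. *)
Lemma red_letter_lt (u : seq nat) x y : y \in u -> x < y ->
  size (undup [seq z <- u | z <= x]) < size (undup [seq z <- u | z <= y]).
Proof.
move=> yu lt_xy.
apply: (@uniq_leq_size _ (y :: undup [seq z <- u | z <= x])).
  by rewrite /= mem_undup mem_filter leqNgt lt_xy undup_uniq.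
move=> z; rewrite inE !mem_undup !mem_filter.
case/predU1P=> [-> | /andP[le_zx ->]]; first by rewrite leqnn yu.
by rewrite (leq_trans le_zx) // ltnW.
Qed.

Lemma red_eq_p211 (u : seq nat) :
  red u = p211 -> exists a b, a < b /\ u = [:: b; a; a].
Proof.
case: u => [|b [|c [|a [|? ?]]]] //; set u := [:: b; c; a] => eq_red.
have [bu cu au] : [/\ b \in u, c \in u & a \in u] by rewrite !inE !eqxx !orbT.
pose rank x := size (undup [seq z <- u | z <= x]).
have [rank_b rank_c rank_a] : [/\ rank b = 2, rank c = 1 & rank a = 1].
  by case: eq_red.
have rank_lt x y : y \in u -> x < y -> rank x < rank y.
  exact: red_letter_lt.
have eq_ca : c = a.
  case: (ltngtP c a) => // lt.
    by have := rank_lt _ _ au lt; rewrite rank_a rank_c.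
  by have := rank_lt _ _ cu lt; rewrite rank_a rank_c.
exists a, b; split; last by rewrite /u eq_ca.
case: (ltngtP a b) => // [lt | eq_ab].
  by have := rank_lt _ _ au lt; rewrite rank_a rank_b.
by move: rank_b; rewrite -eq_ab rank_a.
Qed.

Lemma contains_p211P n (w : seq 'I_n) :
  contains p211 (letters w) <->
  exists a b : 'I_n, a < b /\ subseq [:: b; a; a] w.
Proof.
split=> [[u sub_u /red_eq_p211[a [b [lt_ab def_u]]]] | [a [b [lt_ab sub_w]]]].
  case/subseqP: sub_u => m _; rewrite -map_mask def_u.
  case def_v: (mask m w) => [|b' [|a' [|a'' [|? ?]]]] // [def_b def_a def_a'].
  exists a', b'; split; first by rewrite -ltnS -def_a -def_b.
  have -> : [:: b'; a'; a'] = mask m w.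
    rewrite def_v; congr [:: _; _; _]; apply: val_inj.
    by move: def_a'; rewrite def_a => -[].
  exact: mask_subseq.
exists (letters [:: b; a; a]); first exact: map_subseq.
rewrite /red /= !ltnS !leqnn (ltnW lt_ab) (leqNgt b a) lt_ab /=.
by rewrite !inE !eqxx /= eqSS gtn_eqF.
Qed.

(** * Necessity *)

(** All the copies of the larger neighbor [t] precede the two copies of [y]
    that [subseq_repeat] provides. *)
Lemma p211_of_repeat n (G : rel 'I_n) (w : seq 'I_n) (x y v t : 'I_n) :
    represents12 w G -> y < t -> G y t -> x != y ->
    subseq [:: x; y] w -> subseq [:: y; v] w -> ~~ subseq [:: x; v] w ->
  contains p211 (letters w).
Proof.
case=> w_all repr lt_yt Gyt neq_xy xy yv nxv.
apply/contains_p211P; exists y, t; split=> //.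
have neq_yt : y != t by rewrite neq_ltn lt_yt.
apply: subseq_precede_repeat => //; first by rewrite eq_sym.
  by apply/all_precedeP => //; apply/repr.
exact: subseq_repeat neq_xy xy yv nxv.
Qed.

Section Edges.

Variables (n : nat) (G : rel 'I_n) (w : seq 'I_n).
Hypothesis repr : represents12 w G.

Lemma edge_subseq (x y : 'I_n) : x < y -> G x y = ~~ subseq [:: x; y] w.
Proof.
move=> lt_xy; have neq_xy : x != y by rewrite neq_ltn lt_xy.
case: repr => _ /(_ _ _ lt_xy) Gxy; apply/idP/idP => [/Gxy|].
  by move/(all_precedeP _ neq_xy).
by move/(all_precedeP _ neq_xy)/Gxy.
Qed.

(** Transitivity of complete precedence; it needs an occurrence of the middle
    letter. *)
Lemma edge_trans (x y z : 'I_n) :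
  x < y -> y < z -> G x y -> G y z -> G x z.
Proof.
move=> lt_xy lt_yz; have lt_xz := ltn_trans lt_xy lt_yz.
case: repr => w_all edges /edges prec_yx /edges prec_zy.
have /onthP[c wc] := w_all y; apply/edges => // a b wa wb.
exact: ltn_trans (prec_zy lt_yz _ _ wa wc) (prec_yx lt_xy _ _ wc wb).
Qed.

End Edges.

(** * Sufficiency *)

(** Any repetition of [a] in [d ++ s] uses one copy in [d] and one in [s], and
    nothing larger precedes [a] within [d]. *)
Lemma avoids_p211_cat n (d s : seq 'I_n) :
    sorted (fun x y : 'I_n => x < y) d -> uniq s ->
  avoids p211 (letters (d ++ s)).
Proof.
move=> sort_d uniq_s /contains_p211P[a [b [lt_ab /subseq_split]]].
have nsub_aa u : subseq u s -> ~~ uniq u -> False.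
  by move=> /subseq_uniq-/(_ uniq_s) ->.
case=> -[|b1 [|a1 u1]] [u2 [/= def_u sub1 sub2]].
- by apply: (nsub_aa _ sub2); rewrite -def_u /= !inE eqxx andbF.
- case: def_u => _ def_u; apply: (nsub_aa _ sub2).
  by rewrite -def_u /= inE eqxx.
case: def_u sub1 => <- <- _ sub1.
have lt_trans : transitive (fun x y : 'I_n => x < y).
  by move=> y x z; apply: ltn_trans.
have := subseq_sorted lt_trans sub1 sort_d.
by rewrite /= ltnNge (ltnW lt_ab).
Qed.

Section Ordering.

Variables (n : nat) (G : rel 'I_n).

Definition has_larger_neighbor (x : 'I_n) :=
  [exists y : 'I_n, (x < y) && G x y].

(** [must_precede u v]: in the permutation, [u] has to come before [v]; a pair
    whose smaller vertex has no larger neighbor is left unconstrained. *)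
Definition must_precede (u v : 'I_n) :=
  if u < v then has_larger_neighbor u && ~~ G u v else G u v.

Hypotheses (Gsym : symmetric G) (Girr : irreflexive G).
Hypothesis no_a : ~ (exists x y z : 'I_n,
  [/\ x < y, y < z, G x y, G y z & ~~ G x z]).
Hypothesis no_b : ~ (exists x y z w : 'I_n,
  [/\ x < y, y < z & z < w] /\ [/\ G x w, G y z, ~~ G x y & ~~ G y w]).
Hypothesis no_c : ~ (exists x y z w : 'I_n,
  [/\ x < y, y < z & z < w] /\ [/\ G x z, G y w, ~~ G x y & ~~ G y z]).

(** The 3-cycle with smallest vertex [m] would be [v], [m], [u].  If [v < u] it
    is configuration (a); if [u < v], a larger neighbor of [u] below [v] gives
    (b) and one above [v] gives (c). *)
Lemma no_3cycle (m u v : 'I_n) :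
  m < u -> m < v -> G m v -> ~~ G m u -> ~~ must_precede u v.
Proof.
move=> lt_mu lt_mv Gmv nGmu; apply/negP; rewrite /must_precede.
case: (ltngtP u v) => [lt_uv | lt_vu | eq_uv].
- case/andP=> /existsP[t /andP[lt_ut Gut]] nGuv.
  case: (ltngtP t v) => [lt_tv | lt_vt | /val_inj eq_tv].
  + by apply: no_b; exists m, u, t, v.
  + by apply: no_c; exists m, u, v, t.
  + by rewrite eq_tv (negPf nGuv) in Gut.
- by move=> Guv; apply: no_a; exists m, v, u; rewrite Gsym in Guv.
by rewrite (val_inj eq_uv) Girr.
Qed.

(** Quicksort with the smallest vertex [m] as pivot: its neighbors go before
    it, the others after it.  No requirement crosses the wrong way, by
    [no_3cycle]. *)
Lemma quicksort_ordering (s : seq 'I_n) : sorted (fun x y : 'I_n => x < y) s ->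
  exists w, perm_eq w s && pairwise (fun x y => ~~ must_precede y x) w.
Proof.
have lt_trans : transitive (fun x y : 'I_n => x < y).
  by move=> y x z; apply: ltn_trans.
have [k] := ubnP (size s); elim: k s => // k IHk [|m s] le_sk.
  by exists [::].
rewrite /= (path_sortedE lt_trans) => /andP[/allP gt_m sort_s].
have IHfilter (p : pred 'I_n) : exists w, perm_eq w (filter p s)
    && pairwise (fun x y => ~~ must_precede y x) w.
  apply: IHk; last exact: sorted_filter.
  by rewrite size_filter (leq_ltn_trans (count_size _ _)).
have [w1 /andP[perm1 pair1]] := IHfilter (G m).
have [w2 /andP[perm2 pair2]] := IHfilter (predC (G m)).
exists (w1 ++ m :: w2); apply/andP; split.
  rewrite perm_catC /= perm_cons perm_catC perm_sym.
  by rewrite -(perm_filterC (G m) s) perm_sym perm_cat.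
have in_w1 v : v \in w1 -> m < v /\ G m v.
  by rewrite (perm_mem perm1) mem_filter => /andP[Gmv /gt_m].
have in_w2 u : u \in w2 -> m < u /\ ~~ G m u.
  by rewrite (perm_mem perm2) mem_filter => /andP[nGmu /gt_m].
rewrite pairwise_cat pair1 /= pair2 andbT; apply/andP; split.
  apply/allrelP => v u /in_w1[lt_mv Gmv].
  rewrite inE => /predU1P[-> | /in_w2[lt_mu nGmu]].
    by rewrite /must_precede lt_mv Gmv andbF.
  exact: (no_3cycle lt_mu lt_mv).
apply/allP => u /in_w2[lt_mu nGmu].
by rewrite /must_precede ltnNge (ltnW lt_mu) /= Gsym.
Qed.

(** An edge [x y] with [x < y] forbids the subsequence [x y]: the prefix holds
    no [x], and [s] puts [y] first.  For a nonedge the subsequence comes from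
    [s] if [x] has a larger neighbor, and otherwise from [x] in the prefix and
    [y] in [s]. *)
Lemma represents12_cat (s : seq 'I_n) :
    (forall x, x \in s) -> uniq s ->
    pairwise (fun x y => ~~ must_precede y x) s ->
  represents12 ([seq x <- enum 'I_n | ~~ has_larger_neighbor x] ++ s) G.
Proof.
move=> s_all uniq_s pair_s; split=> [x | x y lt_xy].
  by rewrite mem_cat s_all orbT.
have neq_xy : x != y by rewrite neq_ltn lt_xy.
set d := filter _ _.
have in_d z : (z \in d) = ~~ has_larger_neighbor z.
  by rewrite mem_filter mem_enum andbT.
have s_order u v : subseq [:: u; v] s -> ~~ must_precede v u.
  by move/subseq_pairwise/(_ pair_s); rewrite /= !andbT.
have y_before_x : must_precede y x = G x y.
  by rewrite /must_precede ltnNge (ltnW lt_xy) /= Gsym.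
apply: (iff_trans _ (iff_sym (all_precedeP _ neq_xy))); split.
  move=> Gxy; apply/negP => /subseq_split[u1 [u2 [def_u sub1 sub2]]].
  case: u1 def_u sub1 => [|h u1] /=.
    move=> def_u _; rewrite -def_u in sub2.
    by case/negP: (s_order _ _ sub2); rewrite y_before_x.
  case=> <- _ sub1; have := mem_subseq sub1 (mem_head x u1).
  by rewrite in_d => /existsP[]; exists y; rewrite lt_xy.
apply: contraR => nGxy; case: (boolP (has_larger_neighbor x)) => [up_x | nup_x].
  apply: subseq_trans (suffix_subseq d s).
  case/orP: (subseq2_total neq_xy (s_all x) (s_all y)) => // /s_order.
  by rewrite /must_precede lt_xy up_x nGxy.
rewrite -[[:: x; y]]/([:: x] ++ [:: y]).
by apply: cat_subseq; rewrite sub1seq // in_d.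
Qed.

End Ordering.

Theorem theorem45 (n : nat) (G : rel 'I_n)
    (Gsym : symmetric G) (Girr : irreflexive G) :
  representable12_avoiding p211 G <->
  [/\ ~ (exists x y z : 'I_n,
           [/\ x < y, y < z, G x y, G y z & ~~ G x z]),
      ~ (exists x y z w : 'I_n,
           [/\ x < y, y < z & z < w] /\
           [/\ G x w, G y z, ~~ G x y & ~~ G y w])
    & ~ (exists x y z w : 'I_n,
           [/\ x < y, y < z & z < w] /\
           [/\ G x z, G y w, ~~ G x y & ~~ G y z])].
Proof.
split=> [[s repr avoid] | [no_a no_b no_c]].
  split.
  - case=> x [y [z [lt_xy lt_yz Gxy Gyz /negP[]]]].
    exact: (edge_trans repr lt_xy lt_yz).
  - case=> x [y [z [w [[lt_xy lt_yz lt_zw] [Gxw Gyz nGxy nGyw]]]]].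
    have lt_yw := ltn_trans lt_yz lt_zw; have lt_xw := ltn_trans lt_xy lt_yw.
    have neq_xy : x != y by rewrite neq_ltn lt_xy.
    apply/avoid/(p211_of_repeat (v := w) repr lt_yz Gyz neq_xy).
    + by move: nGxy; rewrite (edge_subseq repr lt_xy) negbK.
    + by move: nGyw; rewrite (edge_subseq repr lt_yw) negbK.
    + by rewrite -(edge_subseq repr lt_xw).
  case=> x [y [z [w [[lt_xy lt_yz lt_zw] [Gxz Gyw nGxy nGyz]]]]].
  have lt_yw := ltn_trans lt_yz lt_zw; have lt_xz := ltn_trans lt_xy lt_yz.
  have neq_xy : x != y by rewrite neq_ltn lt_xy.
  apply/avoid/(p211_of_repeat (v := z) repr lt_yw Gyw neq_xy).
  + by move: nGxy; rewrite (edge_subseq repr lt_xy) negbK.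
  + by move: nGyz; rewrite (edge_subseq repr lt_yz) negbK.
  + by rewrite -(edge_subseq repr lt_xz).
have sort_enum : sorted (fun x y : 'I_n => x < y) (enum 'I_n).
  have := iota_ltn_sorted 0 n.
  by rewrite -val_enum_ord sorted_map.
have [s /andP[perm_s pair_s]] :=
  quicksort_ordering Gsym Girr no_a no_b no_c sort_enum.
have uniq_s : uniq s by rewrite (perm_uniq perm_s) enum_uniq.
have s_all x : x \in s by rewrite (perm_mem perm_s) mem_enum.
exists ([seq x <- enum 'I_n | ~~ has_larger_neighbor G x] ++ s).
  exact: represents12_cat.
apply: avoids_p211_cat => //; apply: sorted_filter => // y x z.
exact: ltn_trans.
Qed.
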